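(* Let $q\in\mathbb{C}$ with $0<|q|<1$. Then $$g_{1,3,3}(-q,q^2,q)+q\,g_{1,3,3}(-q^3,q^4,q)=\sum_{s=-\infty}^{\infty}\mathrm{sg}(s)(-1)^sq^{s(3s+1)/2},$$ $$g_{1,2,2}(-q^{2},-q^{3},q^2)-q\,g_{1,2,2}(-q^4,-q^5,q^2)=-q\sum_{s\in\mathbb{Z}}\mathrm{sg}(s)\,q^{2s^2+3s}.$$
   Context: For a base $Q\in\mathbb{C}$ with $0<|Q|<1$, $x,y\in\mathbb{C}\setminus\{0\}$ and integers $a,b,c$ with $a,c>0$, $b>-\sqrt{ac}$, define $$g_{a,b,c}(x,y,Q):=\Big(\sum_{r,s\ge 0}+\sum_{r,s<0}\Big)(-1)^{r+s}x^ry^sQ^{a\binom{r}{2}+brs+c\binom{s}{2}},$$ where $r,s$ run over integers and $\binom{n}{2}=n(n-1)/2$ for every $n\in\mathbb{Z}$. For an integer $r$, $\mathrm{sg}(r)=1$ if $r\ge 0$ and $\mathrm{sg}(r)=-1$ if $r<0$. *)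

(* Defs.v *)
From mathcomp Require Import all_boot all_order all_algebra.
From mathcomp Require Import complex.
From mathcomp Require Import all_classical all_reals all_analysis.
From mathcomp Require showcase.summability.

Set Implicit Arguments.
Unset Strict Implicit.
Unset Printing Implicit Defensive.

Import Order.TTheory GRing.Theory Num.Theory.
Import numFieldNormedType.Exports.

Local Open Scope ring_scope.
Local Open Scope complex_scope.

(* Unordered summation of a complex family: [summability.sum f] is the limit of
   the finite partial sums of f along the finite subsets of I, directed by
   inclusion. In the finite-dimensional space R[i] this limit exists exactly
   when the family is absolutely convergent. *)
Definition csum (R : realType) (I : choiceType) (f : I -> R[i]) : R[i] :=
  summability.sum (f : I -> (R[i])^o).

(* n(n-1)/2 for every integer n; the division is exact. *)
Definition binz (n : int) : int := (n * (n - 1) %/ 2)%Z.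

(* Unlike [sgz] and [Num.sg], this takes the value 1 at 0. *)
Definition sg (R : realType) (r : int) : R[i] := if 0 <= r then 1 else - 1.

Definition gterm (R : realType) (a b c : int) (x y Q : R[i]) (p : int * int) :
    R[i] :=
  let: (r, s) := p in
  (- 1) ^ (r + s) * x ^ r * y ^ s * Q ^ (a * binz r + b * r * s + c * binz s).

(* Intended for 0 < a, 0 < c, b > - sqrt (a c), 0 < |Q| < 1 and x, y nonzero,
   where both sums converge absolutely. *)
Definition g (R : realType) (a b c : int) (x y Q : R[i]) : R[i] :=
  csum (fun p : int * int =>
          if (0 <= p.1) && (0 <= p.2) then gterm a b c x y Q p else 0)
  + csum (fun p : int * int =>
            if (p.1 < 0) && (p.2 < 0) then gterm a b c x y Q p else 0).

(* Main.v *)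
(** Write f(r,s) and h(r,s) for the general terms of the two double sums of the
    left-hand side, with h carrying the factor q or -q. The exponents are
    quadratic in (r,s) and satisfy h(-r,-s-1) = - f(r,s) for all integers r, s.
    Under this involution the negative quadrant of h cancels the part r > 0 of
    the positive quadrant of f, and the positive quadrant of h cancels the
    negative quadrant of f except for the column r = 0, s < 0, which it
    contributes with a minus sign. What remains is sum_s sg(s) f(0,s); this is
    the first right-hand side, and the second one after s -> -1-s. Everything
    converges absolutely since the exponent of f is at least |r| + |s|. *)
Require Import Defs.
From mathcomp Require Import all_boot all_order all_algebra finmap.
From mathcomp Require Import complex.
From mathcomp Require Import all_classical all_reals all_analysis.
From mathcomp Require Import summability.
From mathcomp Require Import zify ring lra.

Set Implicit Arguments.
Unset Strict Implicit.

Import Order.TTheory GRing.Theory Num.Theory.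
Import numFieldNormedType.Exports.
Local Open Scope ring_scope.
Local Open Scope complex_scope.

(* Unordered summation as a relation *)
#[local] Existing Instance totally_filter.

(** [csum] is a limit operator, with a default value on divergence; the relation also records
    convergence, which addition and reindexing require. *)
Definition has_sum (R : realType) (I : choiceType) (f : I -> R[i]) (l : R[i]) :
    Prop :=
  (partial_sum (f : I -> (R[i])^o) @ totally --> (l : (R[i])^o))%classic.

Section HasSum.
Context {R : realType} {I : choiceType}.
Implicit Types (f g : I -> R[i]) (k l : R[i]).

Lemma has_sumP f l :
  has_sum f l <-> forall e : R[i], 0 < e -> exists A : {fset I},
    forall B : {fset I}, fsubset A B -> `|l - \sum_(i <- B) f i| < e.
Proof.
rewrite /has_sum (@cvgrPdist_lt _ (R[i])^o); split=> H e e0.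
  have [A _ AP] := H e e0; exists A => B AB.
  by have := AP B AB; rewrite /= /partial_sum (big_seq_fsetE _ _ xpredT).
have [A AP] := H e e0; exists A => //= B AB.
by rewrite /partial_sum -(big_seq_fsetE _ _ xpredT); exact: AP.
Qed.

Lemma has_sum_csum f l : has_sum f l -> csum f = l.
Proof. by move=> fl; apply: (cvg_lim _ fl); exact: norm_hausdorff. Qed.

Lemma has_sumD f g k l :
  has_sum f k -> has_sum g l -> has_sum (fun i => f i + g i) (k + l).
Proof.
move=> fk gl; rewrite /has_sum.
have -> : partial_sum (fun i => f i + g i : (R[i])^o) =
    partial_sum (f : I -> (R[i])^o) \+ partial_sum (g : I -> (R[i])^o).
  by apply/funext => A; rewrite /partial_sum /= big_split.
exact: cvgD fk gl.
Qed.

Lemma has_sumM c f l : has_sum f l -> has_sum (fun i => c * f i) (c * l).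
Proof.
move=> fl; rewrite /has_sum.
have -> : partial_sum (fun i => c * f i : (R[i])^o) =
    c \*: partial_sum (f : I -> (R[i])^o).
  by apply/funext => A; rewrite /partial_sum /= scaler_sumr.
exact: (cvgZl_tmp (k := c) fl).
Qed.

End HasSum.

(** Once [B] contains [psi] of [A], the points of [A] outside the image of [B] are zeros of [f], so
    adjoining [A] to that image does not change the sum. This serves both for reindexing by an
    involution and for restriction to a support. *)
Lemma has_sum_inj (R : realType) (I J : choiceType)
    (f : I -> R[i]) (l : R[i]) (phi : J -> I) (psi : I -> J) :
  cancel phi psi -> (forall i, f i != 0 -> phi (psi i) = i) ->
  has_sum f l -> has_sum (f \o phi) l.
Proof.
move=> phiK fpsi /has_sumP fl; apply/has_sumP => e /fl[A AP].
exists [fset psi i | i in A]%fset => B AB.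
have -> : \sum_(j <- B) (f \o phi) j =
    \sum_(i <- ([fset phi j | j in B] `|` A)%fset) f i.
  transitivity (\sum_(i <- [fset phi j | j in B]%fset) f i).
    by rewrite big_imfset //= => ? ? _ _; exact: can_inj phiK _ _.
  apply: big_fset_incl; first exact: fsubsetUl.
  move=> i; rewrite in_fsetU => /orP[-> //|iA] iB; apply/eqP.
  apply: contraNT iB => /fpsi <-; apply: in_imfset => /=.
  by apply: (fsubsetP AB); exact: in_imfset.
by apply: AP; exact: fsubsetUr.
Qed.

(** * Absolute convergence *)

Lemma ler_sum_subseq (R : numDomainType) (T : eqType) (s1 s2 : seq T) (u : T -> R) :
  uniq s1 -> {subset s1 <= s2} -> (forall i, 0 <= u i) ->
  \sum_(i <- s1) u i <= \sum_(i <- s2) u i.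
Proof.
move=> U S u0; pose s := undup s2.
apply: (@le_trans _ _ (\sum_(i <- s) u i)).
  rewrite [leRHS](bigID (mem s1)) /= -[leLHS]addr0 lerD ?sumr_ge0 //.
  rewrite -[X in _ <= X]big_filter le_eqVlt; apply/orP; left; apply/eqP.
  apply: perm_big; apply: uniq_perm; rewrite ?filter_uniq ?undup_uniq // => i.
  by rewrite mem_filter mem_undup; case: (boolP (i \in s1)) => //= /S ->.
rewrite /s; elim: s2 {S s} => [|a s2 IH] //=; rewrite big_cons.
by case: ifP => _; rewrite ?big_cons ?lerD2l // (le_trans IH) // lerDr.
Qed.

Section Absolute.
Context {R : realType} {I : choiceType}.

Lemma has_sum_ge0 (u : I -> R) (M : R) :
  (forall i, 0 <= u i) -> (forall A : {fset I}, \sum_(i <- A) u i <= M) ->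
  exists l : R, has_sum (fun i => (u i)%:C) l%:C.
Proof.
move=> u0 uM; pose E : set R := [set \sum_(i <- A) u i | A in [set: {fset I}]]%classic.
have supE : has_sup E.
  split; first by exists 0, fset0 => //; rewrite big_seq_fset0.
  by exists M => _ [A _ <-].
exists (sup E); apply/has_sumP => e e0.
(* In the order of [R[i]] a positive [e] is real, so approximating the supremum within its real part
   is enough. *)
have e0' : 0 < complex.Re e by move: e0; rewrite ltcE => /andP[].
have [_ [A _ <-] lA] := sup_adherent e0' supE.
exists A => B AB.
rewrite -(raddf_sum (@real_complex R)) -(raddfB (@real_complex R)).
have ES : E (\sum_(i <- B) u i) by exists B.
have AS : \sum_(i <- A) u i <= \sum_(i <- B) u i.
  by apply: ler_sum_subseq => //; exact/fsubsetP.
rewrite ger0_norm; last by rewrite lecR subr_ge0; exact: sup_upper_bound.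
move: e0; rewrite !ltcE /= => /andP[/eqP-> _]; rewrite eqxx /=.
by rewrite ltrBlDr -ltrBlDl (lt_le_trans lA).
Qed.

Lemma has_sum_real (u : I -> R) (M : R) :
  (forall A : {fset I}, \sum_(i <- A) `|u i| <= M) ->
  exists l, has_sum (fun i => (u i)%:C) l.
Proof.
move=> uM.
have P (v : I -> R) : (forall i, 0 <= v i) -> (forall i, v i <= `|u i|) ->
    exists l : R, has_sum (fun i => (v i)%:C) l%:C.
  move=> v0 vu; apply: (@has_sum_ge0 _ M) => // A.
  by apply: le_trans (uM A); apply: ler_sum.
have [|i|k hk] := P (fun i => Num.max (u i) 0).
  by move=> i; rewrite le_max lexx orbT.
  by rewrite ge_max ler_norm normr_ge0.
have [|i|l hl] := P (fun i => Num.max (- u i) 0).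
  by move=> i; rewrite le_max lexx orbT.
  by rewrite ge_max -normrN ler_norm normr_ge0.
exists (k%:C + (-1) * l%:C).
have -> : (fun i => (u i)%:C) =
    (fun i => (Num.max (u i) 0)%:C + (-1) * (Num.max (- u i) 0)%:C).
  apply/funext => i; rewrite mulN1r -(raddfB (@real_complex R)).
  by congr (_%:C); rewrite /Num.max; do 2 case: ifP; lra.
exact: (has_sumD hk (has_sumM (c := -1) hl)).
Qed.

Lemma has_sum_abs (f : I -> R[i]) (M : R[i]) :
  (forall A : {fset I}, \sum_(i <- A) `|f i| <= M) -> exists l, has_sum f l.
Proof.
(* [M] bounds the empty sum, hence is nonnegative and therefore real. *)
move=> fM; have M0 : 0 <= M by have := fM fset0; rewrite big_seq_fset0.
have {}M0 : M = (complex.Re M)%:C.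
  rewrite [LHS]complexE; move: M0; rewrite lecE => /andP[/eqP-> _].
  by rewrite mulr0 addr0.
rewrite {}M0 in fM.
have P (v : I -> R) : (forall i, `|v i|%:C <= `|f i|) ->
    exists l, has_sum (fun i => (v i)%:C) l.
  move=> vf; apply: (@has_sum_real _ (complex.Re M)) => A; rewrite -lecR rmorph_sum /=.
  by apply: le_trans (fM A); apply: ler_sum.
have [|k hk] := P (fun i => complex.Re (f i)); first by move=> i; exact: normc_ge_Re.
have [|l hl] := P (fun i => complex.Im (f i)).
  move=> i; rewrite normc_def lecR -sqrtr_sqr ler_wsqrtr // lerDr sqr_ge0 //.
exists (k + 'i%C * l).
have -> : f = (fun i => (complex.Re (f i))%:C + 'i%C * (complex.Im (f i))%:C).
  by apply/funext => i; exact: complexE.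
exact: (has_sumD hk (has_sumM (c := 'i%C) hl)).
Qed.

End Absolute.

(** * Geometric majorants and the folding involution *)

Section Geometric.
Context {R : realType} {t : R[i]} (t0 : 0 <= t) (t1 : t < 1).

Lemma sum_exp_absz_le (A : seq int) :
  uniq A -> \sum_(n <- A) t ^+ `|n|%N <= 2 / (1 - t).
Proof.
move=> uA; pose N := (\max_(n <- A) `|n|%N).+1.
have geo : \sum_(0 <= k < N) t ^+ k <= 1 / (1 - t).
  rewrite ler_pdivlMr ?subr_gt0 // big_mkord mulrC -opprB mulNr -subrX1 opprB.
  by rewrite gerBl exprn_ge0.
(* Each absolute value occurs at most twice among the integers. Since [Negz k] has absolute value k
   + 1, the negative half is t times the geometric sum. *)
pose B := map Posz (index_iota 0 N) ++ map Negz (index_iota 0 N).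
apply: (@le_trans _ _ (\sum_(n <- B) t ^+ `|n|%N)).
  apply: ler_sum_subseq => // [n nA|n]; last exact: exprn_ge0.
  have : (`|n| < N)%N by rewrite ltnS; exact: leq_bigmax_seq.
  rewrite mem_cat; case: n {nA} => n nN; apply/orP; [left|right].
    by apply: map_f; rewrite mem_index_iota.
  by apply: map_f; rewrite mem_index_iota; exact: ltnW.
rewrite big_cat !big_map /= (_ : 2 / _ = 1 / (1 - t) + 1 / (1 - t)); last first.
  by rewrite -mulrDl.
rewrite lerD //; apply: le_trans geo; apply: ler_sum => k _.
by rewrite exprS ler_piMl ?exprn_ge0 // ltW.
Qed.

(** A finite set of pairs lies in the product of its two projections, over which the majorant
    factors into two one-variable sums. *)
Lemma has_sum_geometric (f : int * int -> R[i]) :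
  (forall p, `|f p| <= t ^+ `|p.1|%N * t ^+ `|p.2|%N) -> exists l, has_sum f l.
Proof.
move=> ft; apply: (@has_sum_abs _ _ _ (2 / (1 - t) * (2 / (1 - t)))) => A.
apply: (@le_trans _ _ (\sum_(p <- A) t ^+ `|p.1|%N * t ^+ `|p.2|%N)).
  exact: ler_sum.
pose A1 := undup [seq p.1 | p <- A]; pose A2 := undup [seq p.2 | p <- A].
pose B := [seq (r, s) | r <- A1, s <- A2].
apply: (@le_trans _ _ (\sum_(p <- B) t ^+ `|p.1|%N * t ^+ `|p.2|%N)).
  apply: ler_sum_subseq => // [[r s] pA|p]; last by rewrite mulr_ge0 ?exprn_ge0.
  apply/allpairsP; exists (r, s); rewrite !mem_undup.
  by split=> //; apply/mapP; exists (r, s).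
rewrite big_allpairs -big_distrlr /= ler_pM ?sum_exp_absz_le ?undup_uniq //.
  by rewrite sumr_ge0 // => *; rewrite exprn_ge0.
by rewrite sumr_ge0 // => *; rewrite exprn_ge0.
Qed.

(** The region where [f] is bounded contains both quadrants and their images under (r,s) ->
    (-r,-s-1), so the four sums converge by estimates on [f] alone. The factor [c] will be q or
    -q. *)
Lemma has_sum_fold (f h : int * int -> R[i]) (c : R[i]) :
  c != 0 ->
  (forall r s : int, 0 <= r /\ 0 <= s \/ r <= 0 /\ s < 0 ->
     `|f (r, s)| <= t ^+ `|r|%N * t ^+ `|s|%N) ->
  (forall r s : int, c * h (- r, - s - 1) = - f (r, s)) ->
  has_sum (fun s => sg R s * f (0, s))
    (csum (fun p => if (0 <= p.1) && (0 <= p.2) then f p else 0)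
      + csum (fun p => if (p.1 < 0) && (p.2 < 0) then f p else 0)
      + c * (csum (fun p => if (0 <= p.1) && (0 <= p.2) then h p else 0)
      + csum (fun p => if (p.1 < 0) && (p.2 < 0) then h p else 0))).
Proof.
move=> c0 ft hf.
have P (D : pred (int * int)) :
    (forall r s, D (r, s) -> 0 <= r /\ 0 <= s \/ r <= 0 /\ s < 0) ->
    exists l, has_sum (fun p => if D p then f p else 0) l.
  move=> DP; apply: has_sum_geometric => -[r s] /=.
  case: ifP => [/DP /ft //|_]; by rewrite normr0 mulr_ge0 ?exprn_ge0.
(* [l3] and [l4] below are the sums of [f] over the images of the two quadrants
   under this involution. *)
pose refl (p : int * int) := (- p.1, - p.2 - 1) : int * int.
have reflK : cancel refl refl by move=> [r s]; rewrite /refl /=; congr pair; lia.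
have hE p : h p = - c^-1 * f (refl p).
  apply: (mulfI c0); rewrite mulrA mulrN divff // mulN1r.
  by rewrite -[p in LHS]reflK; case: (refl p) => r s; exact: hf.
have Q (D : pred (int * int)) l :
    has_sum (fun p => if D (refl p) then f p else 0) l ->
    has_sum (fun p => if D p then h p else 0) (- c^-1 * l).
  move=> /(has_sum_inj reflK (fun p _ => reflK p)).
  move=> /(has_sumM (c := - c^-1)).
  congr has_sum; apply/funext => p /=; rewrite reflK hE.
  by case: ifP; rewrite ?mulr0.
have [|l1 h1] := P (fun p => (0 <= p.1) && (0 <= p.2)); first by move=> r s /=; lia.
have [|l2 h2] := P (fun p => (p.1 < 0) && (p.2 < 0)); first by move=> r s /=; lia.
have [|l3 h3] := P (fun p => (0 <= (refl p).1) && (0 <= (refl p).2)).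
  by move=> r s /=; lia.
have [|l4 h4] := P (fun p => ((refl p).1 < 0) && ((refl p).2 < 0)).
  by move=> r s /=; lia.
rewrite (has_sum_csum h1) (has_sum_csum h2).
rewrite (has_sum_csum (Q (fun p => (0 <= p.1) && (0 <= p.2)) _ h3)).
rewrite (has_sum_csum (Q (fun p => (p.1 < 0) && (p.2 < 0)) _ h4)).
have -> : c * (- c^-1 * l3 + - c^-1 * l4) = -1 * l3 + -1 * l4.
  by rewrite -(mulrDr (- c^-1)) (mulrA c) mulrN (divff c0) mulrDr.
(* The four signed indicators add up to [sg] s on the column r = 0 and to 0 elsewhere. *)
pose k p := (if p.1 == 0 then sg R p.2 else 0) * f p : R[i].
have kl : has_sum k (l1 + l2 + (-1 * l3 + -1 * l4)).
  move: (has_sumD (has_sumD h1 h2)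
    (has_sumD (has_sumM (c := -1) h3) (has_sumM (c := -1) h4))).
  congr has_sum; apply/funext => -[r s]; rewrite /k /refl /sg /=.
  by do !case: ifPn => ?; try lia; ring.
have -> : (fun s => sg R s * f (0, s)) = k \o (fun s : int => (0, s) : int * int).
  by apply/funext => s; rewrite /= /k eqxx.
apply: (has_sum_inj (psi := snd) _ _ kl) => // -[r s].
by rewrite /k /=; case: ifP => [/eqP->//|]; rewrite mul0r eqxx.
Qed.

End Geometric.

(** * Exponents and signs of the general terms *)

(** Doubling removes the division, so that [lia] and [nia] can treat the exponents as
    polynomials. *)
Lemma binzE (n : int) : 2 * binz n = n * (n - 1).
Proof.
have [k [->|->]] : exists k : int, n = 2 * k \/ n = 2 * k + 1.
  by exists (n %/ 2)%Z; lia.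
  by rewrite /binz -mulrA mulKz.
by rewrite /binz addrK mulrCA mulKz // mulrCA.
Qed.

Section Exponents.
Context {R : realType} {q : R[i]} (q0 : q != 0).

Lemma sqr_signz (s : int) : (-1 : R[i]) ^ s * (-1) ^ s = 1.
Proof. by rewrite -expfzMl mulrNN mulr1 exp1rz. Qed.

Lemma norm_signz (s : int) : `|(-1 : R[i]) ^ s| = 1.
Proof.
by case: s => n; rewrite ?NegzE -?invr_expz ?normfV -exprnP normrX normrN1 expr1n ?invr1.
Qed.

(** The sign of the first argument contributes (-1)^r, which cancels that part of (-1)^(r+s). *)
Lemma gterm_sign1 a b c m n (r s : int) :
  gterm a b c (- q ^+ m) (q ^+ n) q (r, s) =
  (-1) ^ s * q ^ (a * binz r + b * r * s + c * binz s + m%:Z * r + n%:Z * s).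
Proof.
have N1 : (-1 : R[i]) != 0 by rewrite oppr_eq0 oner_eq0.
rewrite /gterm -[- q ^+ m]mulN1r expfzMl !(expfzDr _ _ q0) (expfzDr _ _ N1).
rewrite -(exprz_exp q m) -(exprz_exp q n) -!exprnP; have := sqr_signz r; set e := _ ^ r => ee.
transitivity (e * e * ((-1) ^ s * ((q ^+ m) ^ r * (q ^+ n) ^ s *
  (q ^ (a * binz r) * q ^ (b * r * s) * q ^ (c * binz s))))); first by rewrite /e; ring.
by rewrite ee mul1r; ring.
Qed.

Lemma gterm_sign2 a b c m n (r s : int) :
  gterm a b c (- q ^+ m) (- q ^+ n) (q ^+ 2) (r, s) =
  q ^ (2 * (a * binz r + b * r * s + c * binz s) + m%:Z * r + n%:Z * s).
Proof.
have N1 : (-1 : R[i]) != 0 by rewrite oppr_eq0 oner_eq0.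
rewrite /gterm; set E := _ + c * _.
rewrite -[- q ^+ m]mulN1r -[- q ^+ n]mulN1r !(expfzMl (-1)) (expfzDr _ _ N1).
rewrite (expfzDr _ (n%:Z * s) q0) (expfzDr _ (m%:Z * r) q0) -(exprz_exp q 2 E) -(exprz_exp q m) -(exprz_exp q n).
rewrite -!exprnP; have := sqr_signz r; set e := _ ^ r => ee.
have := sqr_signz s; set d := _ ^ s => dd.
transitivity ((e * e) * (d * d) * ((q ^+ m) ^ r * (q ^+ n) ^ s * (q ^+ 2) ^ E)).
  by rewrite /e /d; ring.
by rewrite ee dd !mul1r; ring.
Qed.

Lemma norm_exprz_le (n r s : int) :
  `|q| < 1 -> (`|r|%N + `|s|%N)%:Z <= n ->
  `|q ^ n| <= `|q| ^+ `|r|%N * `|q| ^+ `|s|%N.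
Proof.
move=> q1; case: n => n // rsn; rewrite -exprnP normrX -exprD.
by apply: ler_wiXn2l => //; exact: ltW.
Qed.

End Exponents.

Theorem theorem6p2 (R : realType) (q : R[i]) (hq0 : 0 < `|q|) (hq1 : `|q| < 1) :
  g 1 3 3 (- q) (q ^+ 2) q + q * g 1 3 3 (- q ^+ 3) (q ^+ 4) q
    = csum (fun s : int => sg R s * (- 1) ^ s * q ^ (s * (3 * s + 1) %/ 2)%Z)
  /\
  g 1 2 2 (- q ^+ 2) (- q ^+ 3) (q ^+ 2)
    - q * g 1 2 2 (- q ^+ 4) (- q ^+ 5) (q ^+ 2)
    = - q * csum (fun s : int => sg R s * q ^ (2 * s ^+ 2 + 3 * s)).
Proof.
have q0 : q != 0 by rewrite -normr_gt0.
have qN0 : - q != 0 by rewrite oppr_eq0.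
have N1 : (-1 : R[i]) != 0 by rewrite oppr_eq0 oner_eq0.
have qS (k : int) : q * q ^ k = q ^ (1 + k) by rewrite expfzDr.
have q_ge0 := normr_ge0 q.
(* On each of the two regions |r| + |s| is linear, which keeps absolute values out of the nonlinear
   goals. *)
have bound (r s n : int) : 0 <= r /\ 0 <= s \/ r <= 0 /\ s < 0 ->
    (0 <= r /\ 0 <= s -> r + s <= n) -> (r <= 0 /\ s < 0 -> - r - s <= n) ->
    `|q ^ n| <= `|q| ^+ `|r|%N * `|q| ^+ `|s|%N.
  by move=> rs H1 H2; apply: norm_exprz_le => //; case: rs => rs; 
    [have := H1 rs|have := H2 rs]; lia.
split.
  symmetry; apply: has_sum_csum.
  rewrite (_ : (fun s : int => _) =
      (fun s : int => sg R s * gterm 1 3 3 (- q ^+ 1) (q ^+ 2) q (0, s))).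
    apply: (has_sum_fold q_ge0 hq1 q0) => [r s rs|r s]; rewrite !gterm_sign1 //.
      rewrite normrM norm_signz !mul1r.
      have := binzE r; have := binzE s => bs br.
      (* The exponent is r(r+1)/2 + 3rs + s(3s+1)/2. For r <= 0 the condition s <= -1 is essential:
         it gives 3rs >= -3r. *)
      apply: bound => // -[r0 s0]; nia.
    (* The minus sign comes from the odd shift in (-1)^(-s-1), and the factor q makes up the
       exponent, which is short by 1. *)
    rewrite mulrCA qS -mulNr; congr (_ * q ^ _).
      by rewrite expfzDr // exprN1 -exprz_inv invrN1 mulrN1.
    have := binzE r; have := binzE s; have := binzE (- r); have := binzE (- s - 1).
    lia.
  apply/funext => s; rewrite gterm_sign1 // mulrA; congr (_ * q ^ _).
  have := binzE 0; have := binzE s => b1 b2.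
  rewrite -[RHS](@mulKz _ 2) //; congr (_ %/ _)%Z; lia.
have : has_sum
    (fun s : int => sg R s * gterm 1 2 2 (- q ^+ 2) (- q ^+ 3) (q ^+ 2) (0, s))
    (g 1 2 2 (- q ^+ 2) (- q ^+ 3) (q ^+ 2)
      + - q * g 1 2 2 (- q ^+ 4) (- q ^+ 5) (q ^+ 2)).
  apply: (has_sum_fold q_ge0 hq1 qN0) => [r s rs|r s]; rewrite !gterm_sign2 //.
    have := binzE r; have := binzE s => bs br.
    apply: bound => // -[r0 s0]; nia.
  (* The terms carry no sign here; the minus comes from the factor -q. *)
  rewrite mulNr qS; congr (- (q ^ _)).
  have := binzE r; have := binzE s; have := binzE (- r); have := binzE (- s - 1).
  lia.
rewrite -(mulNr q (g _ _ _ _ _ _)); set L := g _ _ _ _ _ _ + _.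
(* The column has exponent 2s^2 + s. This reflection turns it into 2s^2 + 3s + 1 and flips [sg],
   which accounts for the factor -q on the right. *)
pose refl (s : int) := - 1 - s.
have reflK : cancel refl refl by move=> s; rewrite /refl; lia.
move=> /(has_sum_inj reflK (fun s _ => reflK s)) /(has_sumM (c := (- q)^-1)).
move=> Lrefl; suff /has_sum_csum-> : has_sum
    (fun s : int => sg R s * q ^ (2 * s ^+ 2 + 3 * s)) ((- q)^-1 * L).
  by rewrite mulrA divff // mul1r.
move: Lrefl; congr has_sum.
apply/funext => s; apply: (mulfI qN0); rewrite mulrA divff // mul1r /comp.
rewrite gterm_sign2 // [RHS]mulrCA mulNr qS.
have -> : sg R (refl s) = - sg R s.
  by rewrite /sg /refl; do 2 case: ifPn => ?; rewrite ?opprK //; lia.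
rewrite mulrN mulNr; congr (- (_ * q ^ _)).
by have := binzE 0; have := binzE (refl s); rewrite /refl; lia.
Qed.
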